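(* Let $\varphi,u_1,u_2:\mathbb R_+^2\to\mathbb R_+$ each satisfy properties (I)–(IV) listed in the context. Starting from an interior market state, suppose that the two agents take turns trading with the CFMM and that each active agent makes the utility-maximizing trade for herself, producing an infinite sequence of market states $(\mathbf R^t)_{t\ge0}$. Then the sequence of market states converges to an interior state $(\mathbf r_0^*,\mathbf r_1^*,\mathbf r_2^* )\in(\mathbb R_{++}^2)^3$, and $$p(\varphi,\mathbf r_0^* )=p(u_1,\mathbf r_1^* )=p(u_2,\mathbf r_2^* ).$$
   Context: Notation: $\mathbb R_+=[0,\infty)$, $\mathbb R_{++}=(0,\infty)$. For a function $u$ that is differentiable with nonzero partial derivatives at $\mathbf r=(x,y)$, put $p(u,\mathbf r)=p(u,x,y):=\partial_xu(x,y)/\partial_yu(x,y)$. Properties of a function $u:\mathbb R_+^2\to\mathbb R_+$: (I) $u$ is continuous, $u(x,0)=u(0,y)=0$ for all $x,y\in\mathbb R_+$, and $u$ is strictly increasing (in each coordinate) on $\mathbb R_{++}^2$. (II) $\lim_{x'\to\infty}u(x',y)=\infty$ and $\lim_{y'\to\infty}u(x,y')=\infty$ for every $x,y>0$. (III) $u$ is continuously differentiable and strictly concave on $\mathbb R_{++}^2$. (IV) For any $x_1,x_2,y_1,y_2\in\mathbb R_{++}$ with $x_1\le x_2$ and $y_1\ge y_2$, at least one inequality strict, $p(u,x_1,y_1)>p(u,x_2,y_2)$ whenever the prices are defined. Market: there is one constant-function market maker (CFMM) with trading function $\varphi$ and two agents with utilities $u_1,u_2$. A market state is $\mathbf R=(\mathbf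 r_0,\mathbf r_1,\mathbf r_2)\in(\mathbb R_+^2)^3$ ($\mathbf r_0$ = CFMM inventory, $\mathbf r_i$ = holding of agent $i$); it is interior if it lies in $(\mathbb R_{++}^2)^3$. A trade $\mathbf h\in\mathbb R^2$ is valid for $\mathbf R$ and agent $i\in\{1,2\}$ if $\mathbf r_0+\mathbf h\in\mathbb R_+^2$, $\varphi(\mathbf r_0+\mathbf h)=\varphi(\mathbf r_0)$ and $\mathbf r_i-\mathbf h\in\mathbb R_+^2$; executing it replaces $\mathbf r_0$ by $\mathbf r_0+\mathbf h$, $\mathbf r_i$ by $\mathbf r_i-\mathbf h$, and leaves the other holding unchanged. The utility-maximizing trade of agent $i$ at an interior state is the (unique, under (I)–(IV)) valid trade $\mathbf h$ maximizing $u_i(\mathbf r_i-\mathbf h)$; the resulting state is again interior. ''Taking turns'' means that the agents alternate strictly, one trade each; either agent may go first. *)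

(* Defs.v *)
From Stdlib Require Import Reals.
From Coquelicot Require Import Coquelicot.

Open Scope R_scope.

Definition quadrant (r : R * R) : Prop := 0 <= fst r /\ 0 <= snd r.
Definition open_quadrant (r : R * R) : Prop := 0 < fst r /\ 0 < snd r.

(* Functions on the closed quadrant are represented by total functions on
   [R * R]; every condition below looks only at their values on the quadrant. *)

Definition partial_x (u : R * R -> R) (r : R * R) : R :=
  Derive (fun x => u (x, snd r)) (fst r).
Definition partial_y (u : R * R -> R) (r : R * R) : R :=
  Derive (fun y => u (fst r, y)) (snd r).

Definition price (u : R * R -> R) (r : R * R) : R :=
  partial_x u r / partial_y u r.

(* [price] is total; it is meaningful only where [price_defined] holds. *)
Definition price_defined (u : R * R -> R) (r : R * R) : Prop :=
  ex_filterdiff u (locally r) /\ partial_x u r <> 0 /\ partial_y u r <> 0.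

Definition continuous_on_quadrant (u : R * R -> R) : Prop :=
  forall r, quadrant r ->
    filterlim u (within quadrant (locally r)) (locally (u r)).

Definition strictly_increasing (u : R * R -> R) : Prop :=
  (forall x x' y, 0 < x -> x < x' -> 0 < y -> u (x, y) < u (x', y)) /\
  (forall x y y', 0 < x -> 0 < y -> y < y' -> u (x, y) < u (x, y')).

Definition coordinatewise_unbounded (u : R * R -> R) : Prop :=
  (forall y, 0 < y -> is_lim (fun x => u (x, y)) p_infty p_infty) /\
  (forall x, 0 < x -> is_lim (fun y => u (x, y)) p_infty p_infty).

Definition continuously_differentiable (u : R * R -> R) : Prop :=
  forall r, open_quadrant r ->
    ex_filterdiff u (locally r) /\
    continuous (partial_x u) r /\ continuous (partial_y u) r.

Definition strictly_concave (u : R * R -> R) : Prop :=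
  forall r s t, open_quadrant r -> open_quadrant s -> r <> s -> 0 < t < 1 ->
    t * u r + (1 - t) * u s < u (plus (scal t r) (scal (1 - t) s)).

Definition price_decreasing (u : R * R -> R) : Prop :=
  forall x1 x2 y1 y2,
    0 < x1 -> 0 < x2 -> 0 < y1 -> 0 < y2 ->
    x1 <= x2 -> y1 >= y2 -> (x1 < x2 \/ y1 > y2) ->
    price_defined u (x1, y1) -> price_defined u (x2, y2) ->
    price u (x1, y1) > price u (x2, y2).

Record admissible (u : R * R -> R) : Prop := {
  adm_nonneg : forall r, quadrant r -> 0 <= u r;
  adm_continuous : continuous_on_quadrant u;
  adm_axis_x : forall x, 0 <= x -> u (x, 0) = 0;
  adm_axis_y : forall y, 0 <= y -> u (0, y) = 0;
  adm_increasing : strictly_increasing u;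
  adm_unbounded : coordinatewise_unbounded u;
  adm_C1 : continuously_differentiable u;
  adm_concave : strictly_concave u;
  adm_price : price_decreasing u
}.

Inductive agent : Set := agent1 | agent2.

Definition other (i : agent) : agent :=
  match i with agent1 => agent2 | agent2 => agent1 end.

(* (CFMM inventory, holding of agent 1, holding of agent 2); a plain product,
   so that it carries the product topology. *)
Definition state : Type := ((R * R) * (R * R) * (R * R))%type.

Definition inventory (M : state) : R * R := fst (fst M).

Definition holding (M : state) (i : agent) : R * R :=
  match i with agent1 => snd (fst M) | agent2 => snd M end.

Definition interior_state (M : state) : Prop :=
  open_quadrant (inventory M) /\
  open_quadrant (holding M agent1) /\ open_quadrant (holding M agent2).

Definition valid_trade (phi : R * R -> R) (M : state) (i : agent)
    (h : R * R) : Prop :=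
  quadrant (plus (inventory M) h) /\
  phi (plus (inventory M) h) = phi (inventory M) /\
  quadrant (minus (holding M i) h).

Definition execute (M : state) (i : agent) (h : R * R) : state :=
  match i with
  | agent1 =>
      (plus (inventory M) h, minus (holding M agent1) h, holding M agent2)
  | agent2 =>
      (plus (inventory M) h, holding M agent1, minus (holding M agent2) h)
  end.

Definition utility_maximizing (phi : R * R -> R) (u : agent -> R * R -> R)
    (M : state) (i : agent) (h : R * R) : Prop :=
  valid_trade phi M i h /\
  forall h', valid_trade phi M i h' ->
    u i (minus (holding M i) h') <= u i (minus (holding M i) h).

Definition utilities (u1 u2 : R * R -> R) (i : agent) : R * R -> R :=
  match i with agent1 => u1 | agent2 => u2 end.

Definition active (first : agent) (t : nat) : agent :=
  if Nat.even t then first else other first.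

Definition taking_turns (phi : R * R -> R) (u : agent -> R * R -> R)
    (first : agent) (M : nat -> state) : Prop :=
  forall t, exists h,
    utility_maximizing phi u (M t) (active first t) h /\
    M (S t) = execute (M t) (active first t) h.

(* Main.v *)
Require Import Defs.
From Stdlib Require Import Reals Lra Lia Classical ClassicalEpsilon.
From Coquelicot Require Import Coquelicot.

(** Both agents' utilities are nondecreasing along the play and bounded, since the total
    endowment is conserved; call their limits [U j]. The play stays in a compact box, and as
    the utilities vanish on the axes, every limit point is interior. A trade that does not
    tend to zero would, replaced by its half, eventually push a utility above [U j] by
    strict concavity, so consecutive states have the same limit points. Hence at a limit point
    neither agent has a strictly improving trade, which forces all three marginal prices to
    coincide. That common price supports the three level sets through the limit point, so two
    limit points with the same endowment and the same levels are equal; by compactness the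
    whole sequence converges. *)

(** * Sequential compactness and directional derivatives *)

(** Choose a witness, then restart the search just beyond it. Letting [P] depend on [n] allows a
    tolerance that shrinks along the subsequence. *)
Lemma frequently_subseq (P : nat -> nat -> Prop) :
  (forall n N, exists p, (N <= p)%nat /\ P n p) ->
  exists f : nat -> nat, (forall n, (f n < f (S n))%nat) /\ forall n, P n (f n).
Proof.
  intros H.
  pose (g := fun n N => proj1_sig (constructive_indefinite_description _ (H n N))).
  assert (Hg : forall n N, (N <= g n N)%nat /\ P n (g n N)).
  { intros n N; exact (proj2_sig (constructive_indefinite_description _ (H n N))). }
  pose (f := fix f n := match n with O => g O O | S n => g (S n) (S (f n)) end).
  exists f; split.
  - intros n; destruct (Hg (S n) (S (f n))) as [H1 _].
    change (f (S n)) with (g (S n) (S (f n))); lia.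
  - intros [|n]; apply Hg.
Qed.

(** Computes vector operations on pairs down to real arithmetic, keeping the real operations folded
    so that [field] can close each coordinate. *)
Ltac pair_field :=
  cbv -[Rplus Rmult Ropp Rinv Rminus Rdiv IZR]; f_equal; field.

(** Relative sequential compactness: the limit [l] may lie outside [K]. Where the limits of the play
    lie is settled separately. *)
Definition seq_compact {T : UniformSpace} (K : T -> Prop) : Prop :=
  forall v : nat -> T, (forall n, K (v n)) ->
  exists (f : nat -> nat) (l : T), (forall n, (f n < f (S n))%nat) /\
    filterlim (fun n => v (f n)) eventually (locally l).

Lemma seq_compact_interval (a b : R) : seq_compact (fun x => a <= x <= b).
Proof.
  intros v Hv.
  destruct (Bolzano_Weierstrass v _ (compact_P3 a b) Hv) as [l Hl].
  (* Bolzano-Weierstrass yields only a cluster point; the tolerances [/ (INR n + 1)] turn it into a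
     limit along a subsequence. *)
  destruct (frequently_subseq (fun n p => Rabs (v p - l) < / (INR n + 1))) as [f [Hf Hfl]].
  { intros n N.
    assert (Hn : 0 < / (INR n + 1)) by (apply Rinv_0_lt_compat; pose proof (pos_INR n); lra).
    apply (Hl (fun x => Rabs (x - l) < / (INR n + 1)) N).
    exists (mkposreal _ Hn); intros x Hx; exact Hx. }
  exists f, l; split; [exact Hf|].
  apply filterlim_locally; intros eps.
  destruct (archimed_cor1 eps (cond_pos eps)) as [N [HN HN0]].
  exists N; intros n Hn; unfold ball; simpl; unfold AbsRing_ball, abs, minus, plus, opp; simpl.
  eapply Rlt_trans; [apply Hfl|]; eapply Rle_lt_trans; [|exact HN].
  assert (0 < INR N) by (now apply lt_0_INR).
  apply Rinv_le_contravar; [assumption|].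
  apply le_INR in Hn; lra.
Qed.

Lemma filterlim_to_pair {X : Type} {T U : UniformSpace} {F : (X -> Prop) -> Prop}
    {FF : Filter F} (g : X -> T) (h : X -> U) (x : T) (y : U) :
  filterlim g F (locally x) -> filterlim h F (locally y) ->
  filterlim (fun n => (g n, h n)) F (locally (x, y)).
Proof.
  intros Hg Hh; apply filterlim_locally; intros eps.
  generalize (filter_and _ _ (proj1 (filterlim_locally g x) Hg eps)
    (proj1 (filterlim_locally h y) Hh eps)).
  apply filter_imp; intros n [H1 H2]; split; assumption.
Qed.

(** Extract for the first coordinate, then again for the second; the first limit survives the
    further thinning. *)
Lemma seq_compact_prod {T U : UniformSpace} (K : T -> Prop) (L : U -> Prop) :
  seq_compact K -> seq_compact L -> seq_compact (fun p : T * U => K (fst p) /\ L (snd p)).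
Proof.
  intros HK HL v Hv.
  destruct (HK (fun n => fst (v n)) (fun n => proj1 (Hv n))) as [f [x [Hf Hx]]].
  destruct (HL (fun n => snd (v (f n))) (fun n => proj2 (Hv _))) as [g [y [Hg Hy]]].
  exists (fun n => f (g n)), (x, y); split.
  - intros n; specialize (Hg n).
    induction Hg as [|m Hm IH]; [apply Hf|]. eapply Nat.lt_trans; [exact IH|apply Hf].
  - apply filterlim_ext with (fun n => (fst (v (f (g n))), snd (v (f (g n))))).
    { intros n; symmetry; apply surjective_pairing. }
    apply filterlim_to_pair; [|exact Hy].
    exact (filterlim_comp _ _ _ g (fun n => fst (v (f n))) _ _ _ (eventually_subseq g Hg) Hx).
Qed.

Lemma is_derive_direction (u : R * R -> R) (x y a b : R) :
  ex_filterdiff u (locally (x, y)) ->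
  is_derive (fun t => u (x + t * a, y + t * b)) 0
    (a * partial_x u (x, y) + b * partial_y u (x, y)).
Proof.
  intros [l Hl].
  assert (Hlin : is_linear l) by apply Hl.
  (* By the chain rule the derivative along [(a, b)] is the differential [l] at [(a, b)]; linearity
     then reduces it to the two coordinate directions. *)
  assert (key : forall a b, is_derive (fun t => u (x + t * a, y + t * b)) 0 (l (a, b))).
  { intros a' b'.
    apply (filterdiff_ext_lin _ (fun t : R => l (scal t (a', b'))));
      [|intros t; rewrite (linear_scal l Hlin); reflexivity].
    apply (filterdiff_ext (fun t : R => u (plus (x, y) (scal t (a', b'))))); [reflexivity|].
    apply (filterdiff_comp' (fun t : R => plus (x, y) (scal t (a', b'))) u).
    - apply (filterdiff_ext_lin _ (fun t : R => plus zero (scal t (a', b'))));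
        [|intros t; apply plus_zero_l].
      apply (filterdiff_plus_fct
        (V := prod_NormedModule R_AbsRing R_NormedModule R_NormedModule)
        (fun _ : R => (x, y)) (fun t : R => scal t (a', b'))
        (fun _ => zero) (fun t : R => scal t (a', b'))).
      + apply filterdiff_const.
      + apply filterdiff_linear, (is_linear_scal_l
          (V := prod_NormedModule R_AbsRing R_NormedModule R_NormedModule)).
    - replace (plus (x, y) (scal 0 (a', b'))) with (x, y); [exact Hl|].
      pair_field. }
  (* The partials differentiate at the coordinate itself, [key] differentiates at 0; a translation
     reconciles them. *)
  assert (shift : forall (g : R -> R) z k, is_derive g 0 k ->
      Derive (fun t => g (t - z)) z = k).
  { intros g z k Hg; apply is_derive_unique.
    assert (Hs : is_derive (fun t : R => t - z) z 1) by (auto_derive; [exact I|ring]).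
    replace 0 with (z - z) in Hg by ring.
    rewrite <- (Rmult_1_l k).
    exact (is_derive_comp g (fun t : R => t - z) z k 1 Hg Hs). }
  assert (hx : partial_x u (x, y) = l (1, 0)).
  { rewrite <- (shift _ x _ (key 1 0)); apply Derive_ext; intros t; simpl.
    f_equal; f_equal; ring. }
  assert (hy : partial_y u (x, y) = l (0, 1)).
  { rewrite <- (shift _ y _ (key 0 1)); apply Derive_ext; intros t; simpl.
    f_equal; f_equal; ring. }
  replace (a * partial_x u (x, y) + b * partial_y u (x, y)) with (l (a, b)); [apply key|].
  rewrite hx, hy.
  change (a * l (1, 0) + b * l (0, 1)) with (plus (scal a (l (1, 0))) (scal b (l (0, 1)))).
  rewrite <- !(linear_scal l Hlin), <- (linear_plus l Hlin); f_equal.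
  pair_field.
Qed.

(** Taking [l] itself as the tolerance in the definition of the derivative keeps the difference
    quotient positive. *)
Lemma is_derive_pos_increases (g : R -> R) (l : R) :
  is_derive g 0 l -> 0 < l -> at_right 0 (fun t => g 0 < g t).
Proof.
  intros Hg Hl.
  apply is_derive_Reals in Hg.
  destruct (Hg l Hl) as [d Hd].
  exists d; intros t Ht Ht0.
  assert (Ht' : Rabs t < d).
  { revert Ht; unfold ball; simpl; unfold AbsRing_ball, abs, minus, plus, opp; simpl.
    now rewrite Ropp_0, Rplus_0_r. }
  specialize (Hd t ltac:(lra) Ht'). rewrite Rplus_0_l in Hd.
  apply Rabs_def2 in Hd. destruct Hd as [_ Hd].
  assert (H : 0 < (g t - g 0) / t) by lra.
  apply (Rmult_lt_compat_r t) in H; [|lra].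
  replace ((g t - g 0) / t * t) with (g t - g 0) in H by (field; lra). lra.
Qed.

Lemma open_open_quadrant : open open_quadrant.
Proof.
  apply open_and.
  - apply (open_comp (fst : R * R -> R) (fun x => 0 < x)); [|apply open_gt].
    intros [x y] _; apply continuous_fst.
  - apply (open_comp (snd : R * R -> R) (fun x => 0 < x)); [|apply open_gt].
    intros [x y] _; apply continuous_snd.
Qed.

Lemma open_quadrant_quadrant (r : R * R) : open_quadrant r -> quadrant r.
Proof. intros [H1 H2]; split; apply Rlt_le; assumption. Qed.

(** * Admissible functions *)

Lemma admissible_pos (u : R * R -> R) (r : R * R) :
  admissible u -> open_quadrant r -> 0 < u r.
Proof.
  intros Hu; destruct r as [x y]; intros [Hx Hy]; simpl in *.
  apply Rle_lt_trans with (u (x / 2, y)).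
  - apply (adm_nonneg u Hu); split; simpl; lra.
  - apply (adm_increasing u Hu); lra.
Qed.

(** Admissible functions vanish on the axes. This is what keeps optimal trades and limit points off
    the boundary. *)
Lemma admissible_pos_open (u : R * R -> R) (r : R * R) :
  admissible u -> quadrant r -> 0 < u r -> open_quadrant r.
Proof.
  intros Hu; destruct r as [x y]; intros [Hx Hy] H; simpl in *; split; simpl.
  - destruct Hx as [Hx|Hx]; [exact Hx|].
    subst x; rewrite (adm_axis_y u Hu) in H by assumption; lra.
  - destruct Hy as [Hy|Hy]; [exact Hy|].
    subst y; rewrite (adm_axis_x u Hu) in H by assumption; lra.
Qed.

Lemma admissible_le (u : R * R -> R) (r s : R * R) :
  admissible u -> open_quadrant r -> fst r <= fst s -> snd r <= snd s -> u r <= u s.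
Proof.
  intros Hu; destruct r as [x y], s as [x' y']; intros [Hx Hy] H1 H2; simpl in *.
  destruct (adm_increasing u Hu) as [Ix Iy].
  apply Rle_trans with (u (x', y)).
  - destruct H1 as [H1|H1]; [left; apply Ix; lra|subst; lra].
  - destruct H2 as [H2|H2]; [left; apply Iy; lra|subst; lra].
Qed.

Lemma admissible_lim_quadrant {T : Type} {F : (T -> Prop) -> Prop} {FF : Filter F}
    (u : R * R -> R) (v : T -> R * R) (l : R * R) :
  admissible u -> (forall n, quadrant (v n)) -> quadrant l ->
  filterlim v F (locally l) -> filterlim (fun n => u (v n)) F (locally (u l)).
Proof.
  intros Hu Hv Hl Hlim.
  apply (filterlim_comp _ _ _ v u _ (within quadrant (locally l)) _);
    [|exact (adm_continuous u Hu l Hl)].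
  intros P HP. generalize (Hlim _ HP). unfold filtermap.
  apply filter_imp; intros n Hn; exact (Hn (Hv n)).
Qed.

Lemma admissible_continuous (u : R * R -> R) (r : R * R) :
  admissible u -> open_quadrant r -> continuous u r.
Proof.
  intros Hu Hr P HP.
  change (locally r (fun s => P (u s))).
  generalize (filter_and _ _ (open_open_quadrant r Hr)
    (adm_continuous u Hu r (open_quadrant_quadrant r Hr) P HP)).
  apply filter_imp; intros s [Hs H]; exact (H (open_quadrant_quadrant s Hs)).
Qed.

Definition midpoint (r s : R * R) : R * R := scal (/ 2) (plus r s).

Lemma midpointE (x y x' y' : R) :
  midpoint (x, y) (x', y') = ((x + x') / 2, (y + y') / 2).
Proof.
  pair_field.
Qed.

Lemma open_quadrant_midpoint (r s : R * R) :
  open_quadrant r -> open_quadrant s -> open_quadrant (midpoint r s).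
Proof.
  destruct r, s; rewrite midpointE; intros [H1 H2] [H3 H4]; split; simpl in *; lra.
Qed.

Lemma filterlim_midpoint {T : Type} {F : (T -> Prop) -> Prop} {FF : Filter F}
    (v w : T -> R * R) (a b : R * R) :
  filterlim v F (locally a) -> filterlim w F (locally b) ->
  filterlim (fun n => midpoint (v n) (w n)) F (locally (midpoint a b)).
Proof.
  intros Hv Hw; unfold midpoint.
  apply (filterlim_comp _ _ _ (fun n => plus (v n) (w n)) (fun z => scal (/ 2) z) _
    (locally (plus a b))).
  - eapply filterlim_comp_2; [exact Hv|exact Hw|].
    apply (filterlim_plus (V := prod_NormedModule R_AbsRing R_NormedModule R_NormedModule)).
  - apply (filterlim_scal_r (V := prod_NormedModule R_AbsRing R_NormedModule R_NormedModule)).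
Qed.

Lemma admissible_midpoint (u : R * R -> R) (r s : R * R) :
  admissible u -> open_quadrant r -> open_quadrant s -> r <> s ->
  u r + u s < 2 * u (midpoint r s).
Proof.
  intros Hu Hr Hs Hne.
  generalize (adm_concave u Hu _ _ (/ 2) Hr Hs Hne ltac:(lra)).
  replace (plus (scal (/ 2) r) (scal (1 - / 2) s)) with (midpoint r s); [lra|].
  destruct r, s; pair_field.
Qed.

(** * Gradient inequality, supporting prices and mutually improving trades *)

Lemma admissible_gradient_le (u : R * R -> R) (x y x' y' : R) :
  admissible u -> open_quadrant (x, y) -> open_quadrant (x', y') ->
  u (x', y') - u (x, y) <=
    (x' - x) * partial_x u (x, y) + (y' - y) * partial_y u (x, y).
Proof.
  intros Hu Hr Hs.
  destruct (classic ((x', y') = (x, y))) as [E|Hne].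
  { injection E; intros; subst; lra. }
  apply Rnot_lt_le; intros Hlt.
  set (L := (x' - x) * _ + _) in Hlt.
  (* Up to a constant, [g] is the chord minus the graph. If the inequality failed, [g] would
     increase at 0 and the chord would rise above the graph, against concavity. *)
  pose (g := fun t => t * (u (x', y') - u (x, y)) - u (x + t * (x' - x), y + t * (y' - y))).
  assert (Hg : is_derive g 0 ((u (x', y') - u (x, y)) - L)).
  { apply (is_derive_minus (fun t => t * (u (x', y') - u (x, y)))
      (fun t => u (x + t * (x' - x), y + t * (y' - y)))).
    - auto_derive; [exact I|ring].
    - apply is_derive_direction, (adm_C1 u Hu _ Hr). }
  assert (H01 : at_right 0 (fun t => 0 < t < 1)).
  { exists (mkposreal 1 Rlt_0_1); intros t Ht Ht0; split; [exact Ht0|].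
    revert Ht; unfold ball; simpl; unfold AbsRing_ball, abs, minus, plus, opp; simpl.
    intros Ht; apply Rabs_def2 in Ht; lra. }
  destruct (filter_ex (F := at_right 0) _ (filter_and (F := at_right 0) _ _ (is_derive_pos_increases g _ Hg ltac:(lra)) H01))
    as [t [Ht Ht01]].
  generalize (adm_concave u Hu _ _ t Hs Hr Hne Ht01).
  replace (plus (scal t (x', y')) (scal (1 - t) (x, y)))
    with (x + t * (x' - x), y + t * (y' - y)).
  2: pair_field.
  unfold g in Ht.
  replace (u (x + 0 * (x' - x), y + 0 * (y' - y))) with (u (x, y)) in Ht
    by (f_equal; f_equal; ring).
  lra.
Qed.

(** The weak inequality is applied at the midpoint, where strict concavity adds a strict gain. *)
Lemma admissible_gradient_lt (u : R * R -> R) (x y x' y' : R) :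
  admissible u -> open_quadrant (x, y) -> open_quadrant (x', y') -> (x, y) <> (x', y') ->
  u (x', y') - u (x, y) <
    (x' - x) * partial_x u (x, y) + (y' - y) * partial_y u (x, y).
Proof.
  intros Hu Hr Hs Hne.
  generalize (admissible_midpoint u _ _ Hu Hr Hs Hne); rewrite midpointE.
  generalize (admissible_gradient_le u x y ((x + x') / 2) ((y + y') / 2) Hu Hr).
  intros H. specialize (H ltac:(destruct Hr, Hs; split; simpl in *; lra)). lra.
Qed.

(** Strict monotonicity alone would allow a zero derivative; by concavity the partial dominates the
    positive gain of a unit step. *)
Lemma admissible_partials_pos (u : R * R -> R) (r : R * R) :
  admissible u -> open_quadrant r -> 0 < partial_x u r /\ 0 < partial_y u r.
Proof.
  intros Hu; destruct r as [x y]; intros Hr; pose proof Hr as [Hx Hy]; simpl in *.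
  destruct (adm_increasing u Hu) as [Ix Iy]; split.
  - generalize (admissible_gradient_le u x y (x + 1) y Hu Hr ltac:(split; simpl; lra)).
    generalize (Ix x (x + 1) y Hx ltac:(lra) Hy); lra.
  - generalize (admissible_gradient_le u x y x (y + 1) Hu Hr ltac:(split; simpl; lra)).
    generalize (Iy x y (y + 1) Hx Hy ltac:(lra)); lra.
Qed.

Lemma admissible_price_defined (u : R * R -> R) (r : R * R) :
  admissible u -> open_quadrant r -> price_defined u r.
Proof.
  intros Hu Hr; destruct (admissible_partials_pos u r Hu Hr).
  split; [apply (adm_C1 u Hu r Hr)|lra].
Qed.

(** The gradient inequalities divided by the positive [partial_y]: with the second good as
    numeraire, the budget line through [r] supports its upper level set. *)
Lemma price_supports (u : R * R -> R) (r s : R * R) :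
  admissible u -> open_quadrant r -> open_quadrant s -> u r <= u s ->
  price u r * fst r + snd r <= price u r * fst s + snd s /\
  (r <> s -> price u r * fst r + snd r < price u r * fst s + snd s).
Proof.
  intros Hu; destruct r as [x y], s as [x' y']; intros Hr Hs Hle.
  destruct (admissible_partials_pos u (x, y) Hu Hr) as [Hpx Hpy].
  unfold price; simpl fst; simpl snd.
  assert (E : (x' - x) * partial_x u (x, y) + (y' - y) * partial_y u (x, y) =
    partial_y u (x, y) * (partial_x u (x, y) / partial_y u (x, y) * x' + y' -
      (partial_x u (x, y) / partial_y u (x, y) * x + y))) by (field; lra).
  split; [|intros Hne].
  - generalize (admissible_gradient_le u x y x' y' Hu Hr Hs); rewrite E; intros H.
    apply Rminus_le_0, (Rmult_le_reg_l (partial_y u (x, y))); lra.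
  - generalize (admissible_gradient_lt u x y x' y' Hu Hr Hs Hne); rewrite E; intros H.
    apply Rminus_lt_0, (Rmult_lt_reg_l (partial_y u (x, y))); lra.
Qed.

Lemma admissible_level (u : R * R -> R) (x y c : R) :
  admissible u -> 0 < x -> 0 < y -> 0 < c <= u (x, y) ->
  exists x', 0 < x' <= x /\ u (x', y) = c.
Proof.
  intros Hu Hx Hy [Hc Hcu].
  assert (H0 : u (0, y) = 0) by (apply (adm_axis_y u Hu); lra).
  (* The intermediate value theorem asks for continuity on the whole line, while [u] is controlled
     only on the quadrant; [Rmax 0 t] extends the slice by its value on the axis. *)
  destruct (IVT_gen (fun t => u (Rmax 0 t, y)) 0 x c) as [t [Ht Ht']].
  - intros t; apply continuity_pt_filterlim.
    apply (admissible_lim_quadrant u (fun t => (Rmax 0 t, y)) (Rmax 0 t, y) Hu).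
    + intros s; split; simpl; [apply Rmax_l|lra].
    + split; simpl; [apply Rmax_l|lra].
    + apply filterlim_to_pair; [|apply filterlim_const].
      apply (continuous_ext (fun s => (0 + s + Rabs (0 - s)) / 2)).
      * intros s; unfold Rmax, Rabs; destruct (Rle_dec 0 s), (Rcase_abs (0 - s)); lra.
      * apply continuity_pt_filterlim.
        reg.
  - rewrite !Rmax_right, Rmin_left by lra; lra.
  - rewrite Rmin_left, Rmax_right in Ht by lra.
    rewrite Rmax_right in Ht' by lra.
    exists t; split; [|exact Ht']. split; [|lra].
    destruct Ht as [[Ht|Ht] _]; [exact Ht|]. subst t; lra.
Qed.

(** If the prices differed, a small exchange at a rate strictly between them would benefit both
    sides to first order. *)
Lemma no_mutual_gain_price (phi u : R * R -> R) (r s : R * R) :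
  admissible phi -> admissible u -> open_quadrant r -> open_quadrant s ->
  (forall h, open_quadrant (plus r h) -> open_quadrant (minus s h) ->
    phi r < phi (plus r h) -> u (minus s h) <= u s) ->
  price phi r = price u s.
Proof.
  intros Hphi Hu; destruct r as [x y], s as [x' y']; intros Hr Hs Hno.
  destruct (admissible_partials_pos phi _ Hphi Hr) as [Ha Hb].
  destruct (admissible_partials_pos u _ Hu Hs) as [Ha' Hb'].
  assert (Hdir : forall a b, 0 < a * partial_x phi (x, y) + b * partial_y phi (x, y) ->
    0 < (- a) * partial_x u (x', y') + (- b) * partial_y u (x', y') -> False).
  { intros a b H1 H2.
    assert (Hmove : forall z w a b, open_quadrant (z, w) ->
      at_right 0 (fun t => open_quadrant (z + t * a, w + t * b))).
    { intros z w a0 b0 Hzw; apply filter_le_within.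
      apply (open_comp (fun t : R => (z + t * a0, w + t * b0)) open_quadrant).
      - intros t _; apply filterlim_to_pair.
        + apply (proj1 (continuity_pt_filterlim (fun t => z + t * a0) t)); reg.
        + apply (proj1 (continuity_pt_filterlim (fun t => w + t * b0) t)); reg.
      - exact open_open_quadrant.
      - now rewrite !Rmult_0_l, !Rplus_0_r. }
    generalize (is_derive_pos_increases _ _
      (is_derive_direction phi x y a b (proj1 (adm_C1 phi Hphi _ Hr))) H1); intros I1.
    generalize (is_derive_pos_increases _ _
      (is_derive_direction u x' y' (- a) (- b) (proj1 (adm_C1 u Hu _ Hs))) H2); intros I2.
    destruct (filter_ex (F := at_right 0) _ (filter_and (F := at_right 0) _ _
      (filter_and (F := at_right 0) _ _ I1 I2)
      (filter_and (F := at_right 0) _ _ (Hmove x y a b Hr) (Hmove x' y' (- a) (- b) Hs))))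
      as [t [[J1 J2] [J3 J4]]].
    rewrite !Rmult_0_l, !Rplus_0_r in J1, J2.
    specialize (Hno (t * a, t * b)).
    replace (minus (x', y') (t * a, t * b)) with (x' + t * - a, y' + t * - b) in Hno.
    2: pair_field.
    specialize (Hno J3 J4 J1). lra. }
  assert (Hp : partial_x phi (x, y) = price phi (x, y) * partial_y phi (x, y))
    by (unfold price; field; lra).
  assert (Hq : partial_x u (x', y') = price u (x', y') * partial_y u (x', y'))
    by (unfold price; field; lra).
  set (p := price phi (x, y)) in *. set (q := price u (x', y')) in *.
  rewrite Hp, Hq in Hdir.
  destruct (Rtotal_order p q) as [H|[H|H]]; [exfalso|exact H|exfalso].
  (* The agent values the first good more, so one unit leaves the inventory, paid for at the mean of
     the two prices. *)
  - apply (Hdir (-1) ((p + q) / 2)).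
    + replace (_ + _) with ((q - p) / 2 * partial_y phi (x, y)) by field.
      apply Rmult_lt_0_compat; lra.
    + replace (_ + _) with ((q - p) / 2 * partial_y u (x', y')) by field.
      apply Rmult_lt_0_compat; lra.
  - apply (Hdir 1 (- ((p + q) / 2))).
    + replace (_ + _) with ((p - q) / 2 * partial_y phi (x, y)) by field.
      apply Rmult_lt_0_compat; lra.
    + replace (_ + _) with ((p - q) / 2 * partial_y u (x', y')) by field.
      apply Rmult_lt_0_compat; lra.
Qed.

(* A trade leaving the CFMM better off is dominated by a valid one: hand the surplus of the
   first good back to the agent. *)
Lemma utility_maximizing_ge (phi : R * R -> R) (u : agent -> R * R -> R) (M : state)
    (i : agent) (h h' : R * R) :
  admissible phi -> admissible (u i) -> open_quadrant (inventory M) ->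
  utility_maximizing phi u M i h ->
  open_quadrant (plus (inventory M) h') -> open_quadrant (minus (holding M i) h') ->
  phi (inventory M) <= phi (plus (inventory M) h') ->
  u i (minus (holding M i) h') <= u i (minus (holding M i) h).
Proof.
  intros Hphi Hu Hr [_ Hmax] Hr' Hs' Hle.
  generalize (admissible_pos phi _ Hphi Hr); intros Hpos.
  unfold valid_trade in Hmax.
  destruct (inventory M) as [x y], (holding M i) as [z w], h' as [a b].
  destruct (admissible_level phi (x + a) (y + b) (phi (x, y)) Hphi) as [x' [Hx' E]].
  - apply Hr'.
  - apply Hr'.
  - split; [exact Hpos|exact Hle].
  - assert (Ep : plus (x, y) (x' - x, b) = (x', y + b)).
    { pair_field. }
    destruct Hr' as [Ha Hb], Hs' as [Hc Hd].
    unfold minus, plus, opp in Ha, Hb, Hc, Hd; simpl in Ha, Hb, Hc, Hd.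
    unfold plus, opp in Ha, Hb, Hc, Hd; simpl in Ha, Hb, Hc, Hd.
    (* The intermediate trade [(x' - x, b)] puts the inventory back on its level set; the agent
       keeps the surplus [x + a - x']. *)
    apply Rle_trans with (u i (minus (z, w) (x' - x, b))).
    + apply admissible_le; [exact Hu|split; assumption| |];
        unfold minus, plus, opp; simpl; unfold plus, opp; simpl; lra.
    + apply Hmax; rewrite Ep; repeat split; simpl; try lra;
        unfold minus, plus, opp; simpl; unfold plus, opp; simpl; lra.
Qed.

Lemma closed_quadrant : closed quadrant.
Proof.
  apply closed_and.
  - apply (closed_comp (fst : R * R -> R) (fun x => 0 <= x)); [|apply closed_ge].
    intros [x y]; apply continuous_fst.
  - apply (closed_comp (snd : R * R -> R) (fun x => 0 <= x)); [|apply closed_ge].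
    intros [x y]; apply continuous_snd.
Qed.

(** * Dynamics of the market *)

Lemma continuous_inventory (A : state) : continuous inventory A.
Proof.
  destruct A as [[a b] c]; apply (continuous_comp fst fst); simpl; apply continuous_fst.
Qed.

Lemma continuous_holding (A : state) (j : agent) :
  continuous (fun T => holding T j) A.
Proof.
  destruct A as [[a b] c], j; [|apply continuous_snd].
  apply (continuous_comp fst snd); simpl; [apply continuous_fst|apply continuous_snd].
Qed.

Definition endowment (M : state) : R * R :=
  plus (plus (inventory M) (holding M agent1)) (holding M agent2).

Lemma continuous_endowment (A : state) : continuous endowment A.
Proof.
  apply (continuous_plus (fun T => plus (inventory T) (holding T agent1))
    (fun T => holding T agent2)); [|apply continuous_holding].
  apply (continuous_plus inventory (fun T => holding T agent1));
    [apply continuous_inventory|apply continuous_holding].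
Qed.

Lemma active_S (first : agent) (t : nat) : active first (S t) = other (active first t).
Proof.
  unfold active; rewrite Nat.even_succ, <- Nat.negb_even.
  destruct (Nat.even t), first; reflexivity.
Qed.

(** Monotonicity comes from comparing the optimal trade with the zero trade, the midpoint bound from
    comparing it with its own half. By concavity the half trade does not lower [phi], so
    [utility_maximizing_ge] applies to it. The midpoint bound later rules out persistent trades. *)
Lemma optimal_trade_step (phi : R * R -> R) (u : agent -> R * R -> R) (M : state)
    (i : agent) (h : R * R) :
  admissible phi -> (forall j, admissible (u j)) -> interior_state M ->
  utility_maximizing phi u M i h ->
  interior_state (execute M i h) /\
  phi (inventory (execute M i h)) = phi (inventory M) /\
  endowment (execute M i h) = endowment M /\
  (forall j, u j (holding M j) <= u j (holding (execute M i h) j)) /\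
  (forall j, u j (midpoint (holding M j) (holding (execute M i h) j)) <=
    u j (holding (execute M i h) j)).
Proof.
  intros Hphi Hu HM Hopt.
  pose proof Hopt as [[Hq0 [Hlev Hqi]] _].
  assert (HMj : forall j, open_quadrant (holding M j)) by (intros []; apply HM).
  assert (Hr0 : open_quadrant (inventory M)) by apply HM.
  assert (Einv : inventory (execute M i h) = plus (inventory M) h) by (destruct i; reflexivity).
  assert (Ehold : holding (execute M i h) i = minus (holding M i) h) by (destruct i; reflexivity).
  assert (Eoth : forall j, j <> i -> holding (execute M i h) j = holding M j)
    by (intros [] Hj; destruct i; easy).
  assert (Hr0' : open_quadrant (plus (inventory M) h)).
  { apply (admissible_pos_open phi); [exact Hphi|exact Hq0|].
    rewrite Hlev; apply admissible_pos; assumption. }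
  assert (Hge := fun h' => utility_maximizing_ge phi u M i h h' Hphi (Hu i) Hr0 Hopt).
  assert (Hmon : u i (holding M i) <= u i (minus (holding M i) h)).
  { assert (Ep : plus (inventory M) (0, 0) = inventory M)
      by (destruct (inventory M); pair_field).
    assert (Em : minus (holding M i) (0, 0) = holding M i)
      by (destruct (holding M i); pair_field).
    generalize (Hge (0, 0)); rewrite Ep, Em.
    intros H; apply H; [exact Hr0|apply HMj|apply Rle_refl]. }
  assert (Hri' : open_quadrant (minus (holding M i) h)).
  { apply (admissible_pos_open (u i)); [apply Hu|exact Hqi|].
    eapply Rlt_le_trans; [apply (admissible_pos (u i)); [apply Hu|apply (HMj i)]|exact Hmon]. }
  assert (HMj' : forall j, open_quadrant (holding (execute M i h) j)).
  { intros j; destruct (classic (j = i)) as [->|Hj];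
      [rewrite Ehold; exact Hri'|rewrite (Eoth j Hj); apply HMj]. }
  split; [split; [rewrite Einv; exact Hr0'|split; apply HMj']|].
  split; [rewrite Einv; exact Hlev|].
  split; [|split].
  - unfold endowment; destruct M as [[[a b] [c d]] [e f]], h as [v w], i;
      pair_field.
  - intros j; destruct (classic (j = i)) as [->|Hj];
      [rewrite Ehold; exact Hmon|rewrite (Eoth j Hj); apply Rle_refl].
  - intros j; destruct (classic (j = i)) as [->|Hj].
    + rewrite Ehold.
      assert (Ep : plus (inventory M) (scal (/ 2) h) =
        midpoint (inventory M) (plus (inventory M) h)).
      { destruct (inventory M), h; pair_field. }
      assert (Em : minus (holding M i) (scal (/ 2) h) =
        midpoint (holding M i) (minus (holding M i) h)).
      { destruct (holding M i), h; pair_field. }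
      generalize (Hge (scal (/ 2) h)); rewrite Ep, Em; intros H; apply H.
      * apply open_quadrant_midpoint; assumption.
      * apply open_quadrant_midpoint; [apply HMj|assumption].
      (* Strict concavity needs distinct endpoints, so the zero trade is treated apart. *)
      * destruct (classic (inventory M = plus (inventory M) h)) as [E|Hne].
        -- rewrite <- E; right; f_equal.
           destruct (inventory M); pair_field.
        -- generalize (admissible_midpoint phi _ _ Hphi Hr0 Hr0' Hne); lra.
    + rewrite (Eoth j Hj); right; f_equal.
      destruct (holding M j); pair_field.
Qed.

Lemma taking_turns_invariant (phi : R * R -> R) (u : agent -> R * R -> R)
    (first : agent) (M : nat -> state) :
  admissible phi -> (forall j, admissible (u j)) -> interior_state (M 0%nat) ->
  taking_turns phi u first M ->
  forall t, interior_state (M t) /\ phi (inventory (M t)) = phi (inventory (M 0%nat)) /\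
    endowment (M t) = endowment (M 0%nat).
Proof.
  intros Hphi Hu HM0 HM t; induction t as [|t [IH1 [IH2 IH3]]]; [split; [exact HM0|split; reflexivity]|].
  destruct (HM t) as [h [Hopt ->]].
  destruct (optimal_trade_step phi u (M t) _ h Hphi Hu IH1 Hopt) as [H1 [H2 [H3 _]]].
  rewrite H2, H3; auto.
Qed.

(** * Limit points of the play *)

Lemma limit_point_invariant (phi : R * R -> R) (u : agent -> R * R -> R)
    (first : agent) (M : nat -> state) (U : agent -> R) (f : nat -> nat) (A : state) :
  admissible phi -> (forall j, admissible (u j)) -> interior_state (M 0%nat) ->
  taking_turns phi u first M ->
  (forall j, is_lim_seq (fun t => u j (holding (M t) j)) (U j)) -> (forall j, 0 < U j) ->
  filterlim f eventually eventually ->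
  filterlim (fun n => M (f n)) eventually (locally A) ->
  interior_state A /\ phi (inventory A) = phi (inventory (M 0%nat)) /\
  endowment A = endowment (M 0%nat) /\ forall j, u j (holding A j) = U j.
Proof.
  intros Hphi Hu HM0 HM HU HU0 Hf HA.
  assert (Hinv := taking_turns_invariant phi u first M Hphi Hu HM0 HM).
  assert (Q0 : forall n, quadrant (inventory (M (f n))))
    by (intros n; apply open_quadrant_quadrant, Hinv).
  assert (Qj : forall j n, quadrant (holding (M (f n)) j))
    by (intros j n; apply open_quadrant_quadrant; destruct j; apply Hinv).
  assert (L0 : filterlim (fun n => inventory (M (f n))) eventually (locally (inventory A)))
    by exact (filterlim_comp _ _ _ _ _ _ _ _ HA (continuous_inventory A)).
  assert (Lj : forall j, filterlim (fun n => holding (M (f n)) j) eventually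
      (locally (holding A j)))
    by (intros j; exact (filterlim_comp _ _ _ _ _ _ _ _ HA (continuous_holding A j))).
  assert (QA0 : quadrant (inventory A))
    by exact (closed_filterlim _ _ _ L0 Q0 closed_quadrant).
  assert (QAj : forall j, quadrant (holding A j))
    by (intros j; exact (closed_filterlim _ _ _ (Lj j) (Qj j) closed_quadrant)).
  assert (E0 : phi (inventory A) = phi (inventory (M 0%nat))).
  { apply (filterlim_locally_unique (F := eventually) (fun n => phi (inventory (M (f n))))).
    - apply admissible_lim_quadrant; assumption.
    - apply filterlim_ext with (fun _ => phi (inventory (M 0%nat)));
        [intros n; symmetry; apply Hinv|apply filterlim_const]. }
  assert (Ej : forall j, u j (holding A j) = U j).
  { intros j.
    apply (filterlim_locally_unique (F := eventually) (fun n => u j (holding (M (f n)) j))).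
    - apply (admissible_lim_quadrant (u j)); auto.
    - exact (filterlim_comp _ _ _ f (fun t => u j (holding (M t) j)) _ _ _ Hf (HU j)). }
  (* Closedness gives only the closed quadrant; the positive limit utility [U j] excludes the
     axes. *)
  assert (OAj : forall j, open_quadrant (holding A j))
    by (intros j; apply (admissible_pos_open (u j)); [auto|auto|rewrite Ej; auto]).
  split; [split; [|split; apply OAj]|split; [exact E0|split; [|exact Ej]]].
  - apply (admissible_pos_open phi); [assumption|assumption|].
    rewrite E0; apply admissible_pos; [assumption|apply HM0].
  - apply (filterlim_locally_unique (F := eventually) (fun n => endowment (M (f n)))).
    + exact (filterlim_comp _ _ _ _ _ _ _ _ HA (continuous_endowment A)).
    + apply filterlim_ext with (fun _ => endowment (M 0%nat));
        [intros n; symmetry; apply Hinv|apply filterlim_const].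
Qed.

Lemma state_ext (A B : state) :
  endowment A = endowment B -> (forall j, holding A j = holding B j) -> A = B.
Proof.
  intros HE Hj; generalize (Hj agent1) (Hj agent2); revert HE; clear Hj.
  unfold endowment; destruct A as [[[a b] r1] r2], B as [[[a' b'] s1] s2]; simpl.
  intros HE -> ->; revert HE; destruct s1, s2.
  unfold plus; simpl; unfold prod_plus; simpl; unfold plus; simpl.
  intros HE; injection HE; intros; do 3 f_equal; lra.
Qed.

(** [A] and [B] are limits of consecutive states along one subsequence. Once they coincide, both
    agents get to move at states close to [A], so neither can have an improving trade there. *)
Lemma limit_point_price (phi : R * R -> R) (u : agent -> R * R -> R)
    (first : agent) (M : nat -> state) (U : agent -> R) (f : nat -> nat) (A B : state) :
  admissible phi -> (forall j, admissible (u j)) -> interior_state (M 0%nat) ->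
  taking_turns phi u first M ->
  (forall j, is_lim_seq (fun t => u j (holding (M t) j)) (U j)) -> (forall j, 0 < U j) ->
  (forall j t, u j (holding (M t) j) <= U j) ->
  filterlim f eventually eventually ->
  filterlim (fun n => M (f n)) eventually (locally A) ->
  filterlim (fun n => M (S (f n))) eventually (locally B) ->
  forall j, price phi (inventory A) = price (u j) (holding A j).
Proof.
  intros Hphi Hu HM0 HM HU HU0 HUle Hf HA HB j.
  assert (Hinv := taking_turns_invariant phi u first M Hphi Hu HM0 HM).
  assert (HSf : filterlim (fun n => S (f n)) eventually eventually).
  { apply (filterlim_comp _ _ _ f S _ eventually _ Hf).
    apply eventually_subseq; intros n; lia. }
  destruct (limit_point_invariant phi u first M U f A Hphi Hu HM0 HM HU HU0 Hf HA)
    as [IA [PA [EA UA]]].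
  destruct (limit_point_invariant phi u first M U _ B Hphi Hu HM0 HM HU HU0 HSf HB)
    as [IB [PB [EB UB]]].
  assert (OA : forall i, open_quadrant (holding A i)) by (intros []; apply IA).
  assert (OB : forall i, open_quadrant (holding B i)) by (intros []; apply IB).
  (* If a trade of fixed size occurred infinitely often, half of it would beat the limit
     utility by strict concavity. *)
  assert (EAB : A = B).
  { apply state_ext; [congruence|]; intros i.
    destruct (classic (holding A i = holding B i)) as [E|Hne]; [exact E|exfalso].
    generalize (admissible_midpoint (u i) _ _ (Hu i) (OA i) (OB i) Hne).
    rewrite UA, UB; intros Hlt.
    assert (Hlim : is_lim_seq
      (fun n => u i (midpoint (holding (M (f n)) i) (holding (M (S (f n))) i)))
      (u i (midpoint (holding A i) (holding B i)))).
    { apply (filterlim_comp _ _ _ _ (u i) _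
        (locally (midpoint (holding A i) (holding B i)))).
      - apply filterlim_midpoint;
          [exact (filterlim_comp _ _ _ _ _ _ _ _ HA (continuous_holding A i))
          |exact (filterlim_comp _ _ _ _ _ _ _ _ HB (continuous_holding B i))].
      - apply admissible_continuous; [apply Hu|apply open_quadrant_midpoint; auto]. }
    generalize (is_lim_seq_le _ (fun _ => U i) _ _
      (fun n => ltac:(destruct (HM (f n)) as [h [Hopt E]];
        destruct (optimal_trade_step phi u (M (f n)) _ h Hphi Hu (proj1 (Hinv _)) Hopt)
          as [_ [_ [_ [_ H]]]];
        specialize (H i); rewrite <- E in H;
        exact (Rle_trans _ _ _ H (HUle i _)))) Hlim (is_lim_seq_const (U i))).
    simpl; lra. }
  subst B.
  apply no_mutual_gain_price; [assumption|apply Hu|apply IA|apply OA|].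
  intros h Ho1 Ho2 Hgain; apply Rnot_lt_le; intros Hlt; rewrite UA in Hlt.
  assert (C1 : continuous (fun T => plus (inventory T) h) A).
  { apply (continuous_plus inventory (fun _ => h));
      [apply continuous_inventory|apply continuous_const]. }
  assert (C2 : continuous (fun T => minus (holding T j) h) A).
  { apply (continuous_minus (fun T => holding T j) (fun _ => h));
      [apply continuous_holding|apply continuous_const]. }
  (* All the requirements on the improving trade [h] are open conditions, so the same [h] works at
     every state near [A]. *)
  assert (HG : locally A (fun T => (open_quadrant (plus (inventory T) h) /\
      open_quadrant (minus (holding T j) h)) /\
      phi (inventory A) < phi (plus (inventory T) h) /\
      U j < u j (minus (holding T j) h))).
  { apply filter_and; apply filter_and.
    - exact (C1 _ (open_open_quadrant _ Ho1)).
    - exact (C2 _ (open_open_quadrant _ Ho2)).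
    - exact (continuous_comp _ phi A C1 (admissible_continuous phi _ Hphi Ho1) _
        (open_gt _ _ Hgain)).
    - exact (continuous_comp _ (u j) A C2 (admissible_continuous (u j) _ (Hu j) Ho2) _
        (open_gt _ _ Hlt)). }
  (* If [j] moved at such a state, her optimal trade would do at least as well as [h] and lift her
     utility above its limit [U j]. *)
  assert (Hact : forall t, active first t = j ->
    (open_quadrant (plus (inventory (M t)) h) /\ open_quadrant (minus (holding (M t) j) h)) /\
      phi (inventory A) < phi (plus (inventory (M t)) h) /\
      U j < u j (minus (holding (M t) j) h) -> False).
  { intros t Ht [[G1 G2] [G3 G4]].
    destruct (HM t) as [k [Hopt E]]; rewrite Ht in Hopt, E.
    destruct (Hinv t) as [It [Pt _]].
    generalize (utility_maximizing_ge phi u (M t) j k h Hphi (Hu j) (proj1 It) Hopt G1 G2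
      ltac:(lra)).
    replace (minus (holding (M t) j) k) with (holding (M (S t)) j)
      by (rewrite E; destruct j; reflexivity).
    generalize (HUle j (S t)); lra. }
  destruct (filter_ex (F := eventually) _
    (filter_and (F := eventually) _ _ (HA _ HG) (HB _ HG))) as [n [G G']].
  (* Turns alternate, so [j] moves at [f n] or at [S (f n)], and both states are near [A]. *)
  destruct (classic (active first (f n) = j)) as [Ej|Ej].
  - exact (Hact _ Ej G).
  - apply (Hact (S (f n))); [|exact G'].
    rewrite active_S; destruct (active first (f n)), j; easy.
Qed.

(* The common price is a supporting price for all three level sets, so a second state on
   the same levels would have a strictly more expensive endowment. *)
Lemma equal_price_unique (phi : R * R -> R) (u : agent -> R * R -> R) (A B : state) :
  admissible phi -> (forall j, admissible (u j)) ->
  interior_state A -> interior_state B ->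
  (forall j, price phi (inventory A) = price (u j) (holding A j)) ->
  phi (inventory A) = phi (inventory B) ->
  (forall j, u j (holding A j) = u j (holding B j)) ->
  endowment A = endowment B -> A = B.
Proof.
  intros Hphi Hu [OA0 [OA1 OA2]] [OB0 [OB1 OB2]] Hp E0 Ej EE.
  destruct (price_supports phi _ _ Hphi OA0 OB0 (Req_le _ _ E0)) as [S0 _].
  destruct (price_supports (u agent1) _ _ (Hu _) OA1 OB1 (Req_le _ _ (Ej _))) as [S1 T1].
  destruct (price_supports (u agent2) _ _ (Hu _) OA2 OB2 (Req_le _ _ (Ej _))) as [S2 T2].
  rewrite <- Hp in S1, S2, T1, T2.
  assert (Efst : fst (inventory A) + fst (holding A agent1) + fst (holding A agent2) =
    fst (inventory B) + fst (holding B agent1) + fst (holding B agent2))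
    by exact (f_equal fst EE).
  assert (Esnd : snd (inventory A) + snd (holding A agent1) + snd (holding A agent2) =
    snd (inventory B) + snd (holding B agent1) + snd (holding B agent2))
    by exact (f_equal snd EE).
  apply (f_equal (Rmult (price phi (inventory A)))) in Efst.
  rewrite !Rmult_plus_distr_l in Efst.
  apply state_ext; [exact EE|intros []; apply NNPP; intros Hne].
  - specialize (T1 Hne); lra.
  - specialize (T2 Hne); lra.
Qed.

(** * Convergence of the play *)

Lemma limit_utilities (phi : R * R -> R) (u : agent -> R * R -> R)
    (first : agent) (M : nat -> state) (j : agent) :
  admissible phi -> (forall j, admissible (u j)) -> interior_state (M 0%nat) ->
  taking_turns phi u first M ->
  exists l : R, is_lim_seq (fun t => u j (holding (M t) j)) l /\ 0 < l /\
    forall t, u j (holding (M t) j) <= l.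
Proof.
  intros Hphi Hu HM0 HM.
  assert (Hinv := taking_turns_invariant phi u first M Hphi Hu HM0 HM).
  assert (Hmon : forall t, u j (holding (M t) j) <= u j (holding (M (S t)) j)).
  { intros t; destruct (HM t) as [h [Hopt ->]].
    now apply (optimal_trade_step phi u (M t) _ h Hphi Hu (proj1 (Hinv t)) Hopt). }
  (* Each holding is dominated by the conserved endowment, whose utility is therefore an upper
     bound. *)
  destruct (ex_finite_lim_seq_incr (fun t => u j (holding (M t) j))
    (u j (endowment (M 0%nat))) Hmon) as [l Hl].
  { intros t; destruct (Hinv t) as [[[I0 I0'] [[I1 I1'] [I2 I2']]] [_ <-]].
    apply admissible_le; [apply Hu|destruct j; split; assumption| |];
      unfold endowment, plus; destruct j; simpl in *; unfold plus; simpl; lra. }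
  assert (Hle := is_lim_seq_incr_compare _ _ Hl Hmon).
  exists l; split; [exact Hl|split; [|exact Hle]].
  eapply Rlt_le_trans; [|apply (Hle 0%nat)].
  apply admissible_pos; [apply Hu|destruct j; apply HM0].
Qed.

(** Conservation of the endowment confines every state to a box. Extracting from pairs of a state
    and its successor makes both converge along the same indices; the arbitrary [g] permits a start
    from any subsequence. *)
Lemma seq_compact_taking_turns (phi : R * R -> R) (u : agent -> R * R -> R)
    (first : agent) (M : nat -> state) :
  admissible phi -> (forall j, admissible (u j)) -> interior_state (M 0%nat) ->
  taking_turns phi u first M ->
  forall g : nat -> nat, exists (f : nat -> nat) (A B : state),
    (forall n, (f n < f (S n))%nat) /\
    filterlim (fun n => M (g (f n))) eventually (locally A) /\
    filterlim (fun n => M (S (g (f n)))) eventually (locally B).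
Proof.
  intros Hphi Hu HM0 HM g.
  assert (Hinv := taking_turns_invariant phi u first M Hphi Hu HM0 HM).
  set (e := endowment (M 0%nat)) in Hinv.
  pose (box := fun r : R * R => 0 <= fst r <= fst e /\ 0 <= snd r <= snd e).
  assert (Hbox : seq_compact box).
  { exact (seq_compact_prod _ _ (seq_compact_interval 0 (fst e))
      (seq_compact_interval 0 (snd e))). }
  pose proof (seq_compact_prod _ _ (seq_compact_prod _ _ Hbox Hbox) Hbox) as Hbox3.
  assert (Hin : forall t, (box (inventory (M t)) /\ box (holding (M t) agent1)) /\
      box (holding (M t) agent2)).
  { intros t; destruct (Hinv t) as [[[I0 I0'] [[I1 I1'] [I2 I2']]] [_ He]].
    unfold box; rewrite <- He; unfold endowment, plus; simpl in *; unfold plus; simpl.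
    lra. }
  destruct (seq_compact_prod _ _ Hbox3 Hbox3 (fun n => (M (g n), M (S (g n)))))
    as [f [[A B] [Hf Hlim]]].
  { intros n; split; apply Hin. }
  exists f, A, B; split; [exact Hf|split].
  - exact (filterlim_comp _ _ _ _ _ _ _ _ Hlim (continuous_fst A B)).
  - exact (filterlim_comp _ _ _ _ _ _ _ _ Hlim (continuous_snd A B)).
Qed.

Theorem theorem5 (phi u1 u2 : R * R -> R)
    (hphi : admissible phi) (hu1 : admissible u1) (hu2 : admissible u2)
    (first : agent) (M : nat -> state)
    (hM0 : interior_state (M 0%nat))
    (hM : taking_turns phi (utilities u1 u2) first M) :
  exists r0 r1 r2 : R * R,
    filterlim M eventually (locally (r0, r1, r2)) /\
    interior_state (r0, r1, r2) /\
    (price_defined phi r0 /\ price_defined u1 r1 /\ price_defined u2 r2) /\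
    price phi r0 = price u1 r1 /\ price u1 r1 = price u2 r2.
Proof.
  set (u := utilities u1 u2) in hM.
  assert (Hu : forall j, admissible (u j)) by (intros []; assumption).
  destruct (limit_utilities phi u first M agent1 hphi Hu hM0 hM) as [l1 [L1 [P1 B1]]].
  destruct (limit_utilities phi u first M agent2 hphi Hu hM0 hM) as [l2 [L2 [P2 B2]]].
  pose (U := fun j => match j with agent1 => l1 | agent2 => l2 end).
  assert (HU : forall j, is_lim_seq (fun t => u j (holding (M t) j)) (U j))
    by (intros []; assumption).
  assert (HU0 : forall j, 0 < U j) by (intros []; assumption).
  assert (HUle : forall j t, u j (holding (M t) j) <= U j) by (intros []; assumption).
  assert (Hcpt := seq_compact_taking_turns phi u first M hphi Hu hM0 hM).
  destruct (Hcpt (fun n => n)) as [f [A [B [Hf [HA HB]]]]].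
  apply eventually_subseq in Hf.
  destruct (limit_point_invariant phi u first M U f A hphi Hu hM0 hM HU HU0 Hf HA)
    as [IA [PA [EA UA]]].
  assert (HpA := limit_point_price phi u first M U f A B hphi Hu hM0 hM HU HU0 HUle Hf HA HB).
  (* Otherwise some subsequence [g] stays at least [eps] away from [A]; it has a limit point [A'] of
     its own, and uniqueness forces [A' = A]. *)
  assert (Hlim : filterlim M eventually (locally A)).
  { apply NNPP; intros Hn; apply Hn, filterlim_locally; intros eps.
    apply NNPP; intros Hev.
    destruct (frequently_subseq (fun _ p => ~ ball A eps (M p))) as [g [Hg Hgn]].
    { intros _ N; apply NNPP; intros H; apply Hev; exists N; intros n HnN.
      apply NNPP; intros Hb; apply H; exists n; split; assumption. }
    destruct (Hcpt g) as [k [A' [B' [Hk [HA' _]]]]].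
    assert (Hgk : filterlim (fun n => g (k n)) eventually eventually).
    { exact (filterlim_comp _ _ _ k g _ _ _ (eventually_subseq k Hk)
        (eventually_subseq g Hg)). }
    destruct (limit_point_invariant phi u first M U _ A' hphi Hu hM0 hM HU HU0 Hgk HA')
      as [IA' [PA' [EA' UA']]].
    assert (E : A = A').
    (* Both states share levels and endowment, and the common price at [A] does the separating. *)
    { apply (equal_price_unique phi u); try assumption; [congruence| |congruence].
      intros j; rewrite UA, UA'; reflexivity. }
    subst A'.
    destruct (filter_ex (F := eventually) _
      (proj1 (filterlim_locally (fun n => M (g (k n))) A) HA' eps)) as [n Hn'].
    exact (Hgn _ Hn'). }
  exists (inventory A), (holding A agent1), (holding A agent2).
  destruct IA as [I0 [I1 I2]].
  replace (inventory A, holding A agent1, holding A agent2) with A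
    by (destruct A as [[]]; reflexivity).
  split; [exact Hlim|split; [repeat split; assumption || apply I0 || apply I1 || apply I2|]].
  split; [split; [|split]; apply admissible_price_defined; assumption|].
  rewrite <- (HpA agent1 : _ = price u1 _), <- (HpA agent2 : _ = price u2 _).
  split; reflexivity.
Qed.
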